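(* Let $G$ be a group and let $X$ be a cocompact $G$-cell complex such that the $G$-stabilizer of each $1$-cell of $X$ is finite. Then the following two statements are equivalent: (1) the $1$-skeleton of $X$ is a fine graph and $H_1(X,\mathbb{Z})$ is trivial; (2) $FV_{X,\mathbb{Z}}(k)<\infty$ for every integer $k$.
   Context: All complexes are combinatorial cell complexes and all maps are combinatorial, in the sense of Bridson--Haefliger (Chapter I.8, Appendix): a combinatorial map is continuous and restricts to a homeomorphism from each open cell onto an open cell, and attaching maps of cells are combinatorial for a suitable cell structure on the sphere; in particular each $2$-cell is attached along a closed edge path. All group actions on complexes are by combinatorial maps; a $G$-complex is a complex with such an action of $G$, and it is cocompact if there are finitely many $G$-orbits of cells. A graph is a $1$-dimensional combinatorial complex (loops and multiple edges allowed). A circuit is a simple closed combinatorial path. A graph $\Gamma$ is fine if for every edge $e$ and each integer $L>0$, the number of circuits of length at most $L$ which contain $e$ is finite. For a complex $X$, an orientation is fixed for each cell of positive dimension, so $C_i(X,\mathbb{Z})$ (cellular $i$-chains) is the free abelian group on the $i$-cells; $\|\cdot\|_1$ is the $\ell_1$-norm in this basis (sum of absolute values of coefficients), and $Z_1(X,\mathbb{Z})$ is the group of cellular $1$-cycles. For $\gamma\in Z_1(X,\mathbb{Z})$ set $\|\gamma\|_{\partial,\mathbb{Z}}=\inf\{\|\mu\|_1:\mu\in C_2(X,\mathbb{Z}),\ \partial\mu=\gamma\}$, with $\inf\emptyset=\infty$. The homological Dehn function of $X$ over $\mathbb{Z}$ is $FV_{X,\mathbb{Z}}(k)=\sup\{\|\gamma\|_{\partial,\mathbb{Z}}:\gamma\in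 Z_1(X,\mathbb{Z}),\ \|\gamma\|_1\le k\}$, with $\sup\emptyset=0$. *)

(* Defs.v *)
From HB Require Import structures.
From mathcomp Require Import all_boot all_order all_algebra.
From mathcomp Require Import monoid.
From mathcomp Require Import all_classical all_reals all_analysis.
From mathcomp.multinomials Require Export freeg.

Set Implicit Arguments.
Unset Strict Implicit.
Unset Printing Implicit Defensive.

Import Order.TTheory GRing.Theory Num.Theory.

Local Open Scope classical_set_scope.
Local Open Scope ring_scope.

(* Loops and multiple edges are allowed.  The edge [e] carries a fixed
   orientation, from [src e] to [tgt e]. *)
Record graph := Graph {
  vert : choiceType;
  edge : choiceType;
  src : edge -> vert;
  tgt : edge -> vert }.

(* Oriented edges: [(e, false)] is [e] run from [src e] to [tgt e], and
   [(e, true)] is [e] run backwards. *)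
Definition dart (X : graph) : choiceType := (edge X * bool)%type.

Definition flip (X : graph) (d : dart X) : dart X := (d.1, ~~ d.2).

Definition dtail (X : graph) (d : dart X) : vert X :=
  if d.2 then tgt d.1 else src d.1.

Definition dhead (X : graph) (d : dart X) : vert X := dtail (flip d).

Definition closed_path (X : graph) (p : seq (dart X)) : Prop :=
  p <> [::] /\ cycle [rel d d' : dart X | dhead d == dtail d'] p.

Definition rev_path (X : graph) (p : seq (dart X)) : seq (dart X) :=
  rev (map (@flip X) p).

(* Equality of closed paths up to the choice of base point and direction. *)
Definition same_loop (X : graph) (p q : seq (dart X)) : Prop :=
  exists n, q = rot n p \/ q = rot n (rev_path p).

(* A simple closed path.  Distinctness of the vertices implies that of the
   underlying edges except in length 2, where it must rule out the
   back-and-forth path on a single edge. *)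
Definition circuit (X : graph) (p : seq (dart X)) : Prop :=
  [/\ closed_path p, uniq (map (@dtail X) p) & uniq (map fst p)].

(* A circuit is counted here once for each base point and direction, that is
   at most 2L times, which does not affect finiteness. *)
Definition fine_graph (X : graph) : Prop :=
  forall (e : edge X) (L : nat), (0 < L)%N ->
    finite_set [set p : seq (dart X) |
      [/\ circuit p, (size p <= L)%N & e \in map fst p]].

(* A combinatorial cell complex of arbitrary dimension: the 1-skeleton, the
   2-cells with their attaching closed edge paths, and the (n+3)-cells
   [hcell n].  The attaching maps of the latter are not recorded, because
   1-chains, 2-chains and their boundaries do not involve them: they only
   matter when orbits of cells are counted. *)
Record cell_complex := CellComplex {
  skel1 :> graph;
  face : choiceType;
  attach : face -> seq (dart skel1);
  attach_closed : forall f, closed_path (attach f);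
  hcell : nat -> choiceType }.

(* The effect on cells of a combinatorial map.  Oriented edges are mapped to
   oriented edges, so that an edge may be mapped with its orientation
   reversed, and likewise for 2-cells. *)
Record comb_map (X Y : cell_complex) := CombMap {
  map_vert : vert X -> vert Y;
  map_dart : dart X -> dart Y;
  map_face : face X -> face Y;
  map_hcell : forall n, hcell X n -> hcell Y n;
  map_flip : forall d, map_dart (flip d) = flip (map_dart d);
  map_tail : forall d, dtail (map_dart d) = map_vert (dtail d);
  map_attach : forall f,
    same_loop (map map_dart (attach f)) (attach (map_face f)) }.

Definition is_group_action (G : groupType) (T : Type) (a : G -> T -> T) : Prop :=
  (forall x, a 1%g x = x) /\ (forall g h x, a (g * h)%g x = a g (a h x)).

Record comb_action (G : groupType) (X : cell_complex) := CombAction {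
  comb_act :> G -> comb_map X X;
  act_vert : is_group_action (fun g => map_vert (comb_act g));
  act_dart : is_group_action (fun g => map_dart (comb_act g));
  act_face : is_group_action (fun g => map_face (comb_act g));
  act_hcell : forall n, is_group_action (fun g => @map_hcell _ _ (comb_act g) n) }.

Definition map_edge (X Y : cell_complex) (m : comb_map X Y) (e : edge X) :
  edge Y := (map_dart m (e, false)).1.

Definition map_hcells (X Y : cell_complex) (m : comb_map X Y)
    (c : {n : nat & hcell X n}) : {n : nat & hcell Y n} :=
  Tagged (fun n => hcell Y n) (map_hcell m (tagged c)).

Definition finitely_many_orbits (G : groupType) (T : Type) (a : G -> T -> T) :
  Prop := finite_set (range (fun x => range (fun g => a g x))).

Definition cocompact (G : groupType) (X : cell_complex) (a : comb_action G X) :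
    Prop :=
  [/\ finitely_many_orbits (fun g => map_vert (a g)),
      finitely_many_orbits (fun g => map_edge (a g)),
      finitely_many_orbits (fun g => map_face (a g)) &
      finitely_many_orbits (fun g => map_hcells (a g))].

(* The setwise stabilizer of a 1-cell: it may contain inversions. *)
Definition edge_stabilizer (G : groupType) (X : cell_complex)
    (a : comb_action G X) (e : edge X) : set G :=
  [set g | map_edge (a g) e = e].

Definition boundary1 (X : cell_complex) : {freeg edge X} -> {freeg vert X} :=
  fglift (fun e : edge X => << tgt e >> - << src e >>).

Definition dart_chain (X : graph) (d : dart X) : {freeg edge X} :=
  << (if d.2 then -1 else 1) *g d.1 >>.

(* The 2-cell [f] is oriented by the direction of [attach f]. *)
Definition boundary2 (X : cell_complex) : {freeg face X} -> {freeg edge X} :=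
  fglift (fun f : face X => \sum_(d <- attach f) dart_chain d).

HB.instance Definition _ (X : cell_complex) :=
  GRing.isZmodMorphism.Build {freeg edge X} {freeg vert X} (@boundary1 X)
    (lift_is_additive (fun e : edge X => << tgt e >> - << src e >>)).

HB.instance Definition _ (X : cell_complex) :=
  GRing.isZmodMorphism.Build {freeg face X} {freeg edge X} (@boundary2 X)
    (lift_is_additive (fun f : face X => \sum_(d <- attach f) dart_chain d)).

Definition cycles1 (X : cell_complex) : set {freeg edge X} :=
  [set z | boundary1 z = 0].

Definition boundaries1 (X : cell_complex) : set {freeg edge X} :=
  range (@boundary2 X).

Arguments cycles1 : clear implicits.
Arguments boundaries1 : clear implicits.

(* H_1 = Z_1 / B_1, where B_1 is contained in Z_1 by
   [boundaries1_sub_cycles1] below. *)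
Definition H1_trivial (X : cell_complex) : Prop := cycles1 X = boundaries1 X.

Definition l1norm (K : choiceType) (c : {freeg K}) : int :=
  \sum_(x <- dom c) `|coeff x c|.

(* [ereal_inf set0] is [+oo]. *)
Definition filling_norm (R : realType) (X : cell_complex)
    (z : {freeg edge X}) : \bar R :=
  ereal_inf [set ((l1norm c)%:~R)%:E | c in [set c | boundary2 c = z]].

(* [ereal_sup set0] is [-oo], whence the case distinction. *)
Definition FV (R : realType) (X : cell_complex) (k : int) : \bar R :=
  let S := [set filling_norm R z | z in [set z | cycles1 X z /\ l1norm z <= k]] in
  if S == set0 then 0%E else ereal_sup S.

Lemma boundary1_dart (X : cell_complex) (d : dart X) :
  boundary1 (dart_chain d) = << dhead d >> - << dtail d >> :> {freeg vert X}.
Proof.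
case: d => e b; rewrite /boundary1 /dart_chain liftU /dhead /dtail /=.
by case: b => /=; rewrite ?scale1r // scaleN1r opprB.
Qed.

Lemma boundary1_closed_path (X : cell_complex) (p : seq (dart X)) :
  closed_path p -> boundary1 (\sum_(d <- p) dart_chain d) = 0 :> {freeg vert X}.
Proof.
case: p => [|d p] [] // _ /=.
have telescope q c : path [rel d d' : dart X | dhead d == dtail d'] c q ->
    \sum_(x <- q) (<< dhead x >> - << dtail x >>) =
    << dhead (last c q) >> - << dhead c >> :> {freeg vert X}.
  elim: q c => [|x q IHq] c /=; first by rewrite big_nil subrr.
  by case/andP=> /eqP cx qP; rewrite big_cons (IHq _ qP) cx addrC addrA subrK.
move/telescope; rewrite last_rcons subrr -cats1 big_cat big_seq1 /= => <-.
rewrite raddf_sum big_cons /= boundary1_dart [RHS]addrC; congr (_ + _).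
by apply: eq_bigr => x _; rewrite boundary1_dart.
Qed.

Lemma boundaries1_sub_cycles1 (X : cell_complex) : boundaries1 X `<=` cycles1 X.
Proof.
move=> _ [c _ <-]; rewrite /cycles1 /= -[c]freeg_sumE !raddf_sum /= big1 // => f _.
rewrite /boundary2 liftU -[coeff f c]intz scaler_int raddfMz.
by rewrite /= boundary1_closed_path ?mul0rz //; apply: attach_closed.
Qed.

(* Main.v *)
From HB Require Import structures.
Require Import Defs.
From mathcomp Require Import all_boot all_order all_algebra.
From mathcomp Require Import monoid.
From mathcomp Require Import all_classical all_reals all_analysis.
From mathcomp Require Import zify.

(** The homological Dehn function is finite at [k] exactly when all the 1-cycles
    of norm at most [k] have integral fillings of norm at most one common bound
    ([FV_ltyP]); both implications are proved for this condition.

    Suppose that the 1-skeleton is fine and that H_1 vanishes.  A 1-cycle is a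
    flow on the edges.  Walking along edges in the direction of the flow yields
    a circuit, and subtracting it lowers the norm by exactly its length.  Thus a
    cycle of norm at most [k] is a sum of at most [k] circuits of length at most
    [k] ([fillable_of_circuits]).  By fineness and cocompactness there are only
    finitely many such circuits up to the action of [G], and each of them
    bounds; since the action preserves fillings and their norms, one number [M]
    bounds the filling norms of all of them ([bounded_circuit_filling]).  Every
    cycle of norm at most [k] then has a filling of norm at most [k * M].

    Conversely, suppose that the Dehn function is finite.  Every cycle then has
    a filling, so H_1 vanishes.  For fineness, finiteness of the edge
    stabilizers and cocompactness imply that every edge lies on finitely many
    faces ([finite_star]).  Let a circuit of length at most [L] through [e] have
    a filling of norm at most [N], and keep only the faces of the filling that
    are connected to [e] by a chain of faces of the filling in which consecutive
    ones share an edge.  The boundary of this part agrees with the circuit on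
    the edges it touches and vanishes elsewhere, so it is a cycle supported in
    the circuit and containing [e]; a circuit has no proper nonzero subcycle
    ([circuit_restr_cycle]), so it is the whole circuit.  Since the chains have
    at most [N] faces, the circuit stays in a finite set of edges that depends
    only on [e] and [N] ([cut_filling_near]), and there are finitely many
    circuits of bounded length in it ([fine_of_bounded_filling]). *)

Set Implicit Arguments.
Unset Strict Implicit.
Unset Printing Implicit Defensive.

Import Order.TTheory GRing.Theory Num.Theory.

Local Open Scope classical_set_scope.
Local Open Scope ring_scope.

(** * Finite sets and sequences *)

(** A preimage is chosen as an option, because [T] may be empty. *)
Lemma finite_set_reps (T U : Type) (f : T -> U) :
  finite_set (range f) ->
  exists2 B : set T, finite_set B & forall x, exists2 y, B y & f y = f x.
Proof.
move=> finf.
have inhab : forall u : U, exists o : option T,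
    if o is Some y then f y = u else forall y, f y <> u.
  move=> u; have [[y fy]|nex] := pselect (exists y, f y = u).
    by exists (Some y).
  by exists None => y fy; apply: nex; exists y.
have [r rP] := choice inhab.
exists [set y | (r @` range f) (Some y)].
  apply: (@sub_finite_set _ _ (\bigcup_(o in r @` range f)
      (if o is Some y then [set y] else set0))).
    by move=> y /= ry; exists (Some y).
  apply: bigcup_finite; first exact: finite_image.
  by move=> [y|] _.
move=> x; have := rP (f x).
case rfx: (r (f x)) => [y|] /= fy; last by case: (fy x).
by exists y => //=; exists (f x) => //; exists x.
Qed.

Lemma finite_set_bounded_seq (T : eqType) (A : set T) (n : nat) :
  finite_set A ->
  finite_set [set s : seq T | (size s <= n)%N /\ forall x, x \in s -> A x].
Proof.
move=> finA; elim: n => [|n IHn].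
  apply: (@sub_finite_set _ _ [set [::]]) => //.
  by move=> [|x s] [].
have finU := finite_image2 cons finA IHn.
apply: (@sub_finite_set _ _ ([set [::]] `|` [set x :: s | x in A & s in
   [set s : seq T | (size s <= n)%N /\ forall x, x \in s -> A x]])).
  move=> [|x s] [/= szs sA]; first by left.
  right; exists x; first by apply: sA; rewrite inE eqxx.
  by exists s => //; split=> // y ys; apply: sA; rewrite inE ys orbT.
by rewrite finite_setU.
Qed.

Lemma finite_set_nat_bound (T : eqType) (A : set T) (P : T -> nat -> Prop) :
  finite_set A -> (forall x m n, (m <= n)%N -> P x m -> P x n) ->
  (forall x, A x -> exists n, P x n) -> exists n, forall x, A x -> P x n.
Proof.
move=> /finite_seqP[s ->] mono; elim: s => [|x s IHs] sP.
  by exists 0%N => x.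
have [|m mP] := IHs; first by move=> y ys; apply: sP; rewrite /= inE ys orbT.
have [n xn] : exists n, P x n by apply: sP; rewrite /= inE eqxx.
exists (maxn m n) => y /=; rewrite inE => /orP[/eqP ->|ys].
  by apply: mono xn; rewrite leq_maxr.
by apply: (mono _ m); rewrite ?leq_maxl//; apply: mP.
Qed.

Lemma uniq_map_inj (T U : eqType) (f : T -> U) (s : seq T) :
  uniq (map f s) -> {in s &, injective f}.
Proof.
elim: s => //= x s IHs /andP[fxs us] y z; rewrite !inE.
move=> /predU1P[-> | ys] /predU1P[-> | zs] // fyz; last exact: IHs fyz.
- by case/mapP: fxs; exists z.
- by case/mapP: fxs; exists y.
Qed.

(** * Chains and their norm *)

Section Chains.
Context (K : choiceType).
Implicit Types (c : {freeg K}) (P : pred K).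

Lemma fgliftE (M : lmodType int) (f : K -> M) c :
  fglift f c = \sum_(x <- dom c) coeff x c *: f x.
Proof. by rewrite -{1}[c]Freeg_dom fglift_Freeg /prelift big_map. Qed.

Lemma l1norm_ge0 c : 0 <= l1norm c.
Proof. exact: sumr_ge0. Qed.

Lemma l1normE (s : seq K) c : uniq s -> {subset dom c <= s} ->
  l1norm c = \sum_(x <- s) `|coeff x c|.
Proof.
move=> us sub; rewrite [RHS](bigID (mem (dom c))) /= [X in _ + X]big1; last first.
  by move=> x /coeff_outdom ->; rewrite normr0.
rewrite addr0 -big_filter; apply: perm_big; apply: uniq_perm.
- exact: uniq_dom.
- exact: filter_uniq.
by move=> x; rewrite mem_filter /=; case xc: (x \in dom c) => //=; rewrite sub.
Qed.

Lemma l1norm0 : l1norm (0 : {freeg K}) = 0.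
Proof. by rewrite /l1norm dom0 big_nil. Qed.

Lemma l1norm_eq0 c : l1norm c <= 0 -> c = 0.
Proof.
move=> c0; apply/eqP; rewrite -dom_eq0; case dc: (dom c) => [//|x s].
have : x \in dom c by rewrite dc inE eqxx.
rewrite mem_dom -normr_gt0 => cx; move: c0; rewrite leNgt /l1norm dc big_cons.
by rewrite ltr_wpDr // sumr_ge0.
Qed.

Lemma l1normD (c c' : {freeg K}) : l1norm (c + c') <= l1norm c + l1norm c'.
Proof.
set s := undup (dom c ++ dom c').
have us : uniq s by apply: undup_uniq.
rewrite (@l1normE s (c + c')) // ?(@l1normE s c) // ?(@l1normE s c') //.
- by rewrite -big_split /=; apply: ler_sum => x _; rewrite coeffD ler_normD.
- by move=> x xc; rewrite mem_undup mem_cat xc orbT.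
- by move=> x xc; rewrite mem_undup mem_cat xc.
- by move=> x /domD_subset; rewrite mem_undup.
Qed.

Lemma l1normZ k c : l1norm (k *: c) = `|k| * l1norm c.
Proof.
rewrite (@l1normE (dom c)) ?uniq_dom //; last exact: domZ_subset.
by rewrite mulr_sumr; apply: eq_bigr => x _; rewrite coeffZ normrM.
Qed.

Lemma l1normU k (x : K) : l1norm << k *g x >> = `|k|.
Proof.
rewrite (@l1normE [:: x]) ?big_seq1 ?coeffU ?eqxx ?mulr1 //.
have [->|k0] := eqVneq k 0; first by rewrite freegU0 dom0.
by rewrite domU.
Qed.

Definition restr P : {freeg K} -> {freeg K} :=
  fglift (fun x => if P x then << x >> else 0).

HB.instance Definition _ P :=
  GRing.isZmodMorphism.Build {freeg K} {freeg K} (restr P)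
    (lift_is_additive (fun x => if P x then << x >> else 0)).

Lemma coeff_restr P c x : coeff x (restr P c) = if P x then coeff x c else 0.
Proof.
rewrite -[in RHS](freeg_sumE c) /restr fgliftE !raddf_sum /=.
rewrite (eq_bigr (fun y => if P x then coeff x << coeff y c *g y >> else 0)).
  by case: (P x); rewrite ?big1_eq.
move=> y _; rewrite coeffZ coeffU; have [->|yx] := eqVneq y x.
  by case: (P x); rewrite ?coeff0 ?mulr0 // coeffU eqxx !mulr1.
by case: (P y); case: (P x); rewrite ?coeff0 ?coeffU ?(negPf yx) ?mulr0.
Qed.

Lemma restr_id P c : (forall x, coeff x c != 0 -> P x) -> restr P c = c.
Proof.
move=> cP; apply/eqP/freeg_eqP => x; rewrite coeff_restr.
by case: ifPn => // /(contraNN (cP x)); rewrite negbK => /eqP.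
Qed.

End Chains.

Lemma size_dom_l1norm (K : choiceType) (c : {freeg K}) : (size (dom c))%:Z <= l1norm c.
Proof.
rewrite -sum1_size -[_%:Z]natz natr_sum /l1norm !big_seq; apply: ler_sum => x.
by rewrite mem_dom -normr_gt0 gtz0_ge1.
Qed.

Lemma raddfZ_int (U V : lmodType int) (f : {additive U -> V}) (k : int) (x : U) :
  f (k *: x) = k *: f x.
Proof. by rewrite -[k]intz !scaler_int raddfMz. Qed.

Lemma l1norm_fglift (K K' : choiceType) (f : K -> {freeg K'}) (c : {freeg K}) :
  (forall x, l1norm (f x) <= 1) -> l1norm (fglift f c) <= l1norm c.
Proof.
move=> f1; rewrite fgliftE /l1norm -/(l1norm _).
elim: (dom c) => [|x s IHs]; first by rewrite !big_nil l1norm0.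
rewrite !big_cons (le_trans (l1normD _ _)) // lerD // l1normZ.
by rewrite ler_piMr.
Qed.

(** * Fillings *)

Definition fillable (X : cell_complex) (n : nat) (z : {freeg edge X}) : Prop :=
  exists2 c, boundary2 c = z & l1norm c <= n%:Z.

Lemma fillableW (X : cell_complex) (m n : nat) (z : {freeg edge X}) :
  (m <= n)%N -> fillable m z -> fillable n z.
Proof. by move=> mn [c cz cm]; exists c => //; apply: le_trans cm _; rewrite lez_nat. Qed.

Lemma fillableD (X : cell_complex) (m n : nat) (y z : {freeg edge X}) :
  fillable m y -> fillable n z -> fillable (m + n) (y + z).
Proof.
move=> [c cy cm] [d dz dn]; exists (c + d); first by rewrite raddfD /= cy dz.
by rewrite (le_trans (l1normD _ _)) // PoszD lerD.
Qed.

(** A supremum below [+oo] is at most some natural number, which bounds all the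
    infima at once; an infimum below [+oo] is taken over a nonempty set, so that
    the cycle bounds.  Conversely a uniform bound on fillings bounds the
    supremum. *)
Lemma FV_ltyP (R : realType) (X : cell_complex) (k : int) :
  (FV R X k < +oo)%E <->
  exists N, forall z, cycles1 X z -> l1norm z <= k -> fillable N z.
Proof.
rewrite /FV; set S := [set filling_norm R z | z in _]; split.
  move=> FVoo.
  have [N SN] : exists N : nat, forall x, S x -> (x < N%:R%:E)%E.
    move: FVoo; case: ifPn => [/eqP -> _|_]; first by exists 0%N.
    move=> supoo; have [r supr] : exists r : R, (ereal_sup S <= r%:E)%E.
      move: supoo; case: (ereal_sup S) => [r| |] // _; first by exists r.
      by exists 0; rewrite leNye.
    exists (Num.trunc `|r|).+1 => x Sx.
    apply: le_lt_trans (ereal_sup_ubound Sx) _; apply: le_lt_trans supr _.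
    by rewrite lte_fin (le_lt_trans (ler_norm r)) // truncnS_gt.
  exists N => z cz zk; have /ereal_inf_lt[_ [c [/= cz' <-]]] :
      (filling_norm R z < N%:R%:E)%E by apply: SN; exists z.
  by rewrite lte_fin -[N%:R]/(N%:Z%:~R) ltr_int => /ltW cN; exists c.
move=> [N NP]; case: ifPn => [_|_]; first by rewrite ltry.
apply: (@le_lt_trans _ _ N%:R%:E); last by rewrite ltry.
apply: ge_ereal_sup => _ [z [cz zk] <-].
have [c cz' cN] := NP z cz zk.
apply: (@le_trans _ _ ((l1norm c)%:~R)%:E); last first.
  by rewrite lee_fin -[N%:R]/(N%:Z%:~R) ler_int.
by apply: ereal_inf_lbound; exists c.
Qed.

(** * Chains carried by edge paths *)

Definition path_chain (X : graph) (p : seq (dart X)) : {freeg edge X} :=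
  \sum_(d <- p) dart_chain d.

Lemma coeff_dart_chain (X : graph) (d : dart X) (e : edge X) :
  coeff e (dart_chain d) = (if d.2 then -1 else 1) * (d.1 == e)%:R.
Proof. by rewrite /dart_chain coeffU. Qed.

Lemma dart_chain_flip (X : graph) (d : dart X) : dart_chain (flip d) = - dart_chain d.
Proof. by case: d => e []; rewrite /dart_chain freegUN ?opprK. Qed.

Lemma l1norm_path_chain (X : graph) (p : seq (dart X)) :
  l1norm (path_chain p) <= (size p)%:Z.
Proof.
elim: p => [|d p IHp]; first by rewrite /path_chain big_nil l1norm0.
rewrite /path_chain big_cons (le_trans (l1normD _ _)) //= -add1n PoszD lerD //.
by rewrite l1normU; case: d.2.
Qed.

Lemma path_chain_same_loop (X : graph) (p q : seq (dart X)) : same_loop p q ->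
  exists b : bool, path_chain p = (-1) ^+ b *: path_chain q.
Proof.
have rotE n (r : seq (dart X)) : path_chain (rot n r) = path_chain r.
  by apply: perm_big; rewrite perm_rot.
move=> [n [->|->]]; rewrite rotE; first by exists false; rewrite scale1r.
exists true; rewrite scaleN1r /path_chain /rev_path.
rewrite [in RHS](perm_big (map (@flip X) p)) /=; last by rewrite perm_rev.
rewrite big_map -sumrN; apply: eq_bigr => d _.
by rewrite dart_chain_flip opprK.
Qed.

Lemma coeff_path_chain_out (X : graph) (p : seq (dart X)) (e : edge X) :
  e \notin map fst p -> coeff e (path_chain p) = 0.
Proof.
move=> ep; rewrite /path_chain raddf_sum big1_seq // => -[e' b] /andP[_ dp].
rewrite /= coeff_dart_chain /=; case: eqP => [ee'|]; rewrite ?mulr0 //.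
by case/mapP: ep; exists (e', b).
Qed.

Lemma coeff_boundary2_out (X : cell_complex) (mu : {freeg face X}) (e : edge X) :
  {in dom mu, forall f, e \notin map fst (attach f)} ->
  coeff e (boundary2 mu) = 0.
Proof.
move=> mue; rewrite /boundary2 fgliftE raddf_sum big1_seq // => f /andP[_ fmu].
by rewrite /= coeffZ coeff_path_chain_out ?mulr0 // mue.
Qed.

Lemma boundary1_boundary2 (X : cell_complex) (mu : {freeg face X}) :
  boundary1 (boundary2 mu) = 0.
Proof. by apply: boundaries1_sub_cycles1; exists mu. Qed.

(** * Actions *)

Lemma finite_orbit_reps (G : groupType) (T : Type) (a : G -> T -> T) :
  is_group_action a -> finitely_many_orbits a ->
  exists2 B : set T, finite_set B & forall x, exists2 y, B y & exists g, a g y = x.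
Proof.
move=> [a1 _] /finite_set_reps[B finB BP]; exists B => // x.
have [y By yx] := BP x; exists y => //.
have : range (a^~ x) x by exists 1%g.
by rewrite -yx => -[g _ gy]; exists g.
Qed.

(** A nonempty transporter is a coset of the stabilizer. *)
Lemma finite_transporter (G : groupType) (T : Type) (a : G -> T -> T) (x y : T) :
  is_group_action a -> finite_set [set g | a g x = x] ->
  finite_set [set g | a g x = y].
Proof.
move=> [a1 aM] finx; have [[h hx]|nex] := pselect (exists h, a h x = y).
  apply: sub_finite_set (finite_image (fun s => (h * s)%g) finx) => g /= gx.
  exists (h^-1 * g)%g; last by rewrite mulVKg.
  by rewrite /= aM gx -hx -aM mulVg a1.
by apply: (@sub_finite_set _ _ set0) => // g gx; apply: nex; exists g.
Qed.

Lemma map_edgeE (X Y : cell_complex) (m : comb_map X Y) (d : dart X) :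
  (map_dart m d).1 = map_edge m d.1.
Proof. by case: d => e [] //; rewrite -[(e, true)]/(flip (e, false)) map_flip. Qed.

Lemma map_edges (X Y : cell_complex) (m : comb_map X Y) (p : seq (dart X)) :
  map fst (map (map_dart m) p) = map (map_edge m) (map fst p).
Proof. by rewrite -!map_comp; apply: eq_map => d /=; rewrite map_edgeE. Qed.

Lemma map_head (X Y : cell_complex) (m : comb_map X Y) (d : dart X) :
  dhead (map_dart m d) = map_vert m (dhead d).
Proof. by rewrite /dhead -map_flip map_tail. Qed.

Lemma same_loop_edges (X : graph) (p q : seq (dart X)) :
  same_loop p q -> map fst p =i map fst q.
Proof.
move=> [n [->|->]] e; first by rewrite map_rot mem_rot.
rewrite map_rot mem_rot /rev_path map_rev mem_rev -map_comp.
by congr (_ \in _); apply: eq_map.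
Qed.

Section Action.
Context (G : groupType) (X : cell_complex) (a : comb_action G X).

Lemma act_edge : is_group_action (fun g => map_edge (a g)).
Proof.
have [d1 dM] := act_dart a.
split=> [e|g h e]; first by rewrite /map_edge d1.
by rewrite /map_edge dM map_edgeE.
Qed.

Lemma act_edge_inj g : injective (map_edge (a g)).
Proof.
have [e1 eM] := act_edge.
by apply: (can_inj (g := map_edge (a g^-1%g))) => e; rewrite -eM mulVg e1.
Qed.

Lemma act_vert_inj g : injective (map_vert (a g)).
Proof.
have [v1 vM] := act_vert a.
by apply: (can_inj (g := map_vert (a g^-1%g))) => v; rewrite -vM mulVg v1.
Qed.

(** Up to the action there are finitely many pairs of a face and an edge on
    it, and a fixed such pair is moved onto a given edge by a coset of a finite
    stabilizer. *)
Lemma finite_star (e : edge X) : cocompact a ->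
  (forall e : edge X, finite_set (edge_stabilizer a e)) ->
  finite_set [set f : face X | e \in map fst (attach f)].
Proof.
move=> [_ _ cocf _] finstab.
have [B finB BP] := finite_orbit_reps (act_face a) cocf.
apply: (@sub_finite_set _ _ (\bigcup_(y in B)
    \bigcup_(e' in [set` map fst (attach y)])
       (fun g => map_face (a g) y) @` [set g | map_edge (a g) e' = e])).
  move=> f /= ef; have [y By [g gy]] := BP f.
  exists y => //; move: ef.
  rewrite -gy -(same_loop_edges (map_attach (a g) y)) map_edges => /mapP[e' e'y ->].
  by exists e' => //; exists g.
apply: bigcup_finite => // y _; apply: bigcup_finite.
  by apply/finite_seqP; eexists.
move=> e' _; apply: finite_image; apply: finite_transporter act_edge _.
exact: finstab.
Qed.

End Action.

(** * Fillings bounded in norm force fineness *)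

(** Vanishing of the boundary at the vertex joining two consecutive darts
    forces the second to lie in [C] when the first does, because no
    other dart of the circuit starts there. *)
Lemma circuit_restr_cycle (X : cell_complex) (p : seq (dart X))
    (C : pred (edge X)) :
  circuit p -> boundary1 (restr C (path_chain p)) = 0 ->
  has C (map fst p) -> all C (map fst p).
Proof.
move=> [[_ cp] up _] bp.
have step : {in p &, forall d d', dhead d == dtail d' -> C d.1 -> C d'.1}.
  move=> d d' dp d'p /eqP dd' Cd; apply/negPn/negP => nCd'.
  have restrE x : restr C (dart_chain x) = if C x.1 then dart_chain x else 0.
    rewrite /dart_chain /restr liftU; case: (C x.1); rewrite ?scaler0 //.
    by apply/eqP/freeg_eqP => y; rewrite coeffZ !coeffU mul1r.
  have := congr1 (coeff (dtail d')) bp.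
  rewrite coeff0 /path_chain !raddf_sum /=.
  rewrite big_seq (eq_bigr (fun x : dart X => (C x.1 && (dhead x == dtail d'))%:R : int)).
    rewrite -big_seq (big_rem d) //= Cd dd' eqxx /= => /eqP.
    by rewrite gt_eqF // ltr_pwDl // sumr_ge0.
  move=> x xp; rewrite restrE; case: ifP => Cx; rewrite ?raddf0 //=.
  rewrite boundary1_dart coeffB !coeffU !mul1r.
  case: (dtail x =P dtail d') => [xd'|_]; last by rewrite subr0.
  have xd'E : x = d' by apply: (uniq_map_inj up).
  by rewrite xd'E (negPf nCd') in Cx.
move=> /hasP[e /mapP[d dp ->] Cd]; apply/allP => _ /mapP[d' d'p ->].
suff /allrelP/(_ d d' dp d'p)/implyP/(_ Cd) :
    all2rel [rel x y : dart X | C x.1 ==> C y.1] p by [].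
rewrite -cycle_all2rel; last by move=> y x z /implyP xy /implyP yz; apply/implyP => /xy.
  apply: (@sub_in_cycle _ (mem p)) cp; last exact/allP.
  by move=> x y xp yp xy; apply/implyP; apply: step.
Qed.

(** Starting from [A], add all the edges of all the faces that touch [A], and
    repeat [n] times: the star condition keeps the result [B] finite.  Each
    stage either meets a face of [mu] not met before, which can happen at most
    [n] times, or meets none.  Let [C] be the stage at which the growth stops:
    every face of [mu] has either all or none of its edges in [C], so that
    restricting the boundary of [mu] to [C] gives the boundary of a part of
    [mu], hence a cycle. *)
Lemma cut_filling_near (X : cell_complex) :
  (forall e : edge X, finite_set [set f : face X | e \in map fst (attach f)]) ->
  forall (n : nat) (A : seq (edge X)), exists2 B : seq (edge X), {subset A <= B} &
  forall mu : {freeg face X}, (size (dom mu) <= n)%N -> exists C : seq (edge X),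
    [/\ {subset A <= C}, {subset C <= B} &
        boundary1 (restr (mem C) (boundary2 mu)) = 0].
Proof.
move=> star; elim=> [|n IHn] A.
  exists A => // mu; rewrite leqn0 size_eq0 dom_eq0 => /eqP ->.
  by exists A; split=> //; rewrite !raddf0.
pose touches f := has (mem A) (map fst (attach f)).
have /finite_seqP[F FE] : finite_set [set f : face X | touches f].
  apply: (@sub_finite_set _ _ (\bigcup_(e in [set` A])
            [set f : face X | e \in map fst (attach f)])).
    by move=> f /hasP[e ef eA]; exists e.
  by apply: bigcup_finite => [|e _]; [apply/finite_seqP; exists A | apply: star].
pose A' := A ++ flatten [seq map fst (attach f) | f <- F].
have AA' : {subset A <= A'} by move=> e eA; rewrite mem_cat eA.
have FA' f e : touches f -> e \in map fst (attach f) -> e \in A'.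
  move=> tf ef; rewrite mem_cat; apply/orP; right; apply/flatten_mapP; exists f => //.
  by have : [set f | touches f] f by []; rewrite FE.
have [B A'B BP] := IHn A'; exists B; first by move=> e /AA' /A'B.
move=> mu szmu; have [/hasP[f fmu tf]|/hasPn ntouch] := boolP (has touches (dom mu)).
  (* The faces touching [A] are supported in [A'], hence in any [C] found for
     the rest [nu]; they contribute a whole boundary to the restriction. *)
- pose nu := restr (predC touches) mu.
  have nuE : restr touches mu = mu - nu.
    apply/eqP/freeg_eqP => x; rewrite coeffB !coeff_restr /=.
    by case: (touches x); rewrite ?subr0 ?subrr.
  have sznu : (size (dom nu) <= n)%N.
    rewrite -ltnS; apply: leq_trans szmu; apply: (@uniq_leq_size _ (f :: dom nu)).
      by rewrite /= uniq_dom mem_dom coeff_restr /= tf eqxx.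
    move=> x; rewrite inE => /predU1P[-> //|]; rewrite !mem_dom coeff_restr.
    by case: ifP => // _; rewrite eqxx.
  have [C [A'C CB bC]] := BP nu sznu; exists C; split=> //; first by move=> e /AA' /A'C.
  rewrite -[mu](subrK nu) -nuE !raddfD /= bC addr0 restr_id ?boundary1_boundary2 //.
  move=> e; apply: contra_neqT => eC; apply: coeff_boundary2_out => x.
  rewrite mem_dom coeff_restr; case: ifP => [tx _|_ /eqP//].
  by apply: contra eC => ex; apply: A'C; apply: FA' ex.
exists A; split=> //; first by move=> e /AA' /A'B.
suff -> : restr (mem A) (boundary2 mu) = 0 by rewrite raddf0.
apply/eqP/freeg_eqP => e; rewrite coeff_restr coeff0; case: ifP => //= eA.
apply: coeff_boundary2_out => f /ntouch; apply: contra => ef.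
by apply/hasP; exists e.
Qed.

(** A filling of norm at most [N] of a circuit through [e] is cut near [e]: the
    part of the circuit lying in the cutting set is a cycle containing [e], so
    it is the whole circuit.  Hence all the circuits in question run in one
    finite set of edges, which depends only on [e] and [N]. *)
Lemma fine_of_bounded_filling (X : cell_complex) :
  (forall e : edge X, finite_set [set f : face X | e \in map fst (attach f)]) ->
  (forall L : nat, exists N, forall p : seq (dart X), circuit p -> (size p <= L)%N ->
     fillable N (path_chain p)) ->
  fine_graph X.
Proof.
move=> star fill e L _; have [N fillN] := fill L.
have [B eB BP] := cut_filling_near star N [:: e].
have finD : finite_set [set d : dart X | d.1 \in B].
  apply: (@sub_finite_set _ _ ([set` B] `*` [set: bool])); first by move=> d.
  by apply: finite_setX; [apply/finite_seqP; exists B | exact: finite_finset].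
apply: sub_finite_set (finite_set_bounded_seq L finD) => p [cp szp ep].
split=> // d dp; have [mu mup muN] := fillN p cp szp.
have [|C [eC CB bC]] := BP mu.
  by rewrite -lez_nat (le_trans (size_dom_l1norm _)).
rewrite /=; apply: CB.
have /allP allC : all (mem C) (map fst p).
  apply: (circuit_restr_cycle cp); first by rewrite -mup.
  by apply/hasP; exists e => //; apply: eC; rewrite inE.
by apply: allC; apply: map_f.
Qed.

(** * Decomposition of cycles into circuits *)

(** The multiplicity with which [z] runs through an edge in the direction of a
    given dart. *)
Definition flow (X : graph) (z : {freeg edge X}) (d : dart X) : int :=
  (if d.2 then -1 else 1) * coeff d.1 z.

(** Conservation of flow at the tail of [d]: if no dart with positive flow
    entered this vertex, every edge would contribute at most [0] to the
    coefficient of the boundary there, and the edge of [d] less than [0]. *)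
Lemma flow_pred (X : cell_complex) (z : {freeg edge X}) (d : dart X) :
  cycles1 X z -> 0 < flow z d -> exists2 d', 0 < flow z d' & dhead d' = dtail d.
Proof.
move=> zc dpos; apply/not_exists2P => nopred.
have flow_le d' : dhead d' = dtail d -> flow z d' <= 0.
  by move=> d'd; rewrite leNgt; apply/negP; case: (nopred d').
(* The contribution of [e] to the boundary at the tail of [d]. *)
pose t e := coeff e z * ((tgt e == dtail d)%:R - (src e == dtail d)%:R).
have tle e : t e <= 0.
  rewrite /t mulrBr; move: (dtail d) flow_le => v flow_le.
  have := flow_le (e, false); have := flow_le (e, true).
  rewrite /flow /dhead /dtail /= mulN1r mul1r oppr_le0.
  case: (src e =P v) => [sv /(_ sv) c1|_ _];
    case: (tgt e =P v) => [tv /(_ tv) c2|_ _];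
    rewrite ?(mulr1, mulr0, subr0, subrr) //; lia.
have := congr1 (coeff (dtail d)) zc; rewrite coeff0 /boundary1 fgliftE raddf_sum /=.
rewrite (eq_bigr t); last by move=> e _; rewrite coeffZ coeffB !coeffU !mul1r.
have ddom : d.1 \in dom z.
  by rewrite mem_dom; apply: contraTneq dpos => dz; rewrite /flow dz mulr0.
rewrite (big_rem _ ddom) /= => /eqP; rewrite lt_eqF // ltr_nwDl //; last exact: sumr_le0.
case: d {nopred} dpos flow_le @t {tle ddom} => e b; rewrite /flow /dtail /dhead /=.
case: b => /=; rewrite eqxx ?mulN1r ?mul1r => epos.
  move=> /(_ (e, true)) /=; rewrite mulN1r; case: eqP => [ee /(_ ee)|_ _].
    by rewrite leNgt epos.
  by rewrite subr0 mulr1 -oppr_gt0.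
move=> /(_ (e, false)) /=; rewrite mul1r; case: eqP => [ee /(_ ee)|_ _].
  by rewrite leNgt epos.
by rewrite sub0r mulrN1 oppr_lt0.
Qed.

(** Walk backwards along darts with positive flow.  There are finitely many
    such darts, so a vertex is visited again, and the first repetition closes up
    a circuit.  Its edges are distinct because a dart and its reverse cannot
    both have positive flow. *)
Lemma positive_circuit (X : cell_complex) (z : {freeg edge X}) :
  cycles1 X z -> z <> 0 -> exists2 p : seq (dart X),
    circuit p & {in p, forall d, 0 < flow z d}.
Proof.
move=> zc z0.
pose adj := [rel d d' : dart X | dhead d == dtail d'].
pose D : seq (dart X) := [seq (e, b) | e <- dom z, b <- [:: true; false]].
have posD d : 0 < flow z d -> d \in D.
  case: d => e b dpos; apply/allpairsP; exists (e, b); split=> //=;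
    last by case: b {dpos}.
  by rewrite mem_dom; apply: contraTneq dpos => dz; rewrite /flow dz mulr0.
have uniq_edges p : {in p, forall d, 0 < flow z d} -> uniq (map (@dtail X) p) ->
    uniq (map fst p).
  move=> ppos /map_uniq up; rewrite map_inj_in_uniq // => -[e b] [e' b'] dp d'p /= ee'.
  move: (ppos _ dp) (ppos _ d'p); rewrite /flow /= -ee'.
  by case: b {dp}; case: b' {d'p} => //; rewrite mulN1r mul1r oppr_gt0 => /lt_trans h /h;
     rewrite ltxx.
(* The walk is stored with its earliest dart first, so that each step backwards
   is a cons; [n] bounds the number of steps left. *)
have extend n d q : {in d :: q, forall x, 0 < flow z x} -> path adj d q ->
    uniq (map (@dtail X) (d :: q)) -> (size D < size (d :: q) + n)%N ->
    exists2 p : seq (dart X), circuit p & {in p, forall d, 0 < flow z d}.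
  elim: n d q => [|n IHn] d q pos pth utl.
    rewrite addn0 ltnNge uniq_leq_size //; first exact: map_uniq utl.
    by move=> x /pos /posD.
  move=> szD; have [d' d'pos d'd] := flow_pred zc (pos d (mem_head _ _)).
  have pth' : path adj d' (d :: q) by rewrite /= d'd eqxx.
  have pos' : {in d' :: d :: q, forall x, 0 < flow z x}.
    by move=> x; rewrite inE => /predU1P[-> //|/pos].
  have [/mapP[x xin xd']|notin] :=
    boolP (dtail d' \in map (@dtail X) (d :: q)); last first.
    by apply: IHn pos' pth' _ _; rewrite /= ?notin // -addSnnS in szD *.
  case/splitPr: xin utl pth' pos' {IHn pos pth szD} => p1 p2 utl pth' pos'.
  have pos1 : {in d' :: p1, forall y, 0 < flow z y}.
    move=> y yp1; apply: pos'; rewrite -cat_cons mem_cat yp1 //.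
  have utl1 : uniq (map (@dtail X) (d' :: p1)).
    move: utl; rewrite map_cat cat_uniq /= xd' => /and3P[-> /norP[-> _] _] //.
  exists (d' :: p1) => //; split=> //; last exact: uniq_edges.
  split=> //=; move: pth'; rewrite cat_path rcons_path /= => /and3P[-> lx _] /=.
  by rewrite xd'.
case dz: (dom z) => [|e s]; first by case: z0; apply/eqP; rewrite -dom_eq0 dz.
have ez : coeff e z != 0 by rewrite -mem_dom dz inE eqxx.
pose d : dart X := (e, coeff e z < 0).
apply: (extend (size D) d [::]) => //.
move=> x; rewrite inE => /eqP ->; rewrite /flow /d /=.
by case: (ltrP (coeff e z) 0) => cz; move: ez cz; lia.
Qed.

Lemma l1norm_sub_dart (X : graph) (z : {freeg edge X}) (d : dart X) :
  0 < flow z d -> l1norm (z - dart_chain d) = l1norm z - 1.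
Proof.
move=> dpos; have ddom : d.1 \in dom z.
  by rewrite mem_dom; apply: contraTneq dpos => dz; rewrite /flow dz mulr0.
have sub : {subset dom (z - dart_chain d) <= dom z}.
  move=> x; rewrite mem_dom coeffB coeff_dart_chain.
  by case: (d.1 =P x) => [<- //|_]; rewrite mulr0 subr0 -mem_dom.
rewrite (l1normE (uniq_dom z) sub) [l1norm z]/l1norm.
rewrite !(bigD1_seq _ ddom (uniq_dom _)) /= addrAC; congr (_ + _); last first.
  apply: eq_bigr => x /negPf xd.
  by rewrite coeffB coeff_dart_chain eq_sym xd mulr0 subr0.
rewrite coeffB coeff_dart_chain eqxx mulr1; move: dpos; rewrite /flow.
by case: d.2 => /=; lia.
Qed.

(** Each dart of [p] brings one coefficient closer to [0] by [1], and no
    coefficient is used twice. *)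
Lemma l1norm_sub_path (X : graph) (z : {freeg edge X}) (p : seq (dart X)) :
  {in p, forall d, 0 < flow z d} -> uniq (map fst p) ->
  l1norm (z - path_chain p) = l1norm z - (size p)%:Z.
Proof.
elim: p z => [|d p IHp] z pos; first by rewrite /path_chain big_nil !subr0.
move=> /= /andP[dp up]; rewrite /path_chain big_cons opprD addrA IHp //.
  by rewrite l1norm_sub_dart ?pos ?mem_head // -addrA -opprD.
move=> x xp; rewrite /flow coeffB coeff_dart_chain.
case: eqP => [dx|_]; first by rewrite dx map_f in dp.
by rewrite mulr0 subr0; apply: pos; rewrite inE xp orbT.
Qed.

(** Splitting off circuits along which the flow is positive decreases the norm
    by their lengths, so a cycle of norm at most [n] is a sum of at most [n]
    circuits of length at most [n]. *)
Lemma fillable_of_circuits (X : cell_complex) (M k : nat) :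
  (forall p : seq (dart X), circuit p -> (size p <= k)%N ->
     fillable M (path_chain p)) ->
  forall (n : nat) z, cycles1 X z -> l1norm z <= n%:Z -> (n <= k)%N ->
    fillable (n * M) z.
Proof.
move=> circ n; have fill0 m : @fillable X m 0.
  by exists 0; rewrite ?raddf0 // l1norm0.
elim: n => [|n IHn] z zc zn nk; first by rewrite (l1norm_eq0 zn).
have [->//|/eqP z0] := eqVneq z 0.
have [p cp pos] := positive_circuit zc z0.
have [[pne _] _ up] := cp; have normp := l1norm_sub_path pos up.
have szp : (0 < size p)%N by rewrite lt0n size_eq0; apply/eqP.
have := l1norm_ge0 (z - path_chain p); rewrite normp => norm_ge0.
rewrite mulSn -[z](subrK (path_chain p)) addrC; apply: fillableD.
  by apply: circ => //; apply: leq_trans nk;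
    rewrite -lez_nat (le_trans _ zn) // -subr_ge0.
apply: IHn; last exact: ltnW.
  by rewrite /cycles1 /= raddfB /= zc boundary1_closed_path ?subrr //; case: cp.
by rewrite normp lerBlDr (le_trans zn) // -PoszD lez_nat -addn1 leq_add2l.
Qed.

(** * Push-forward of fillings *)

Section Pushforward.
Context (X Y : cell_complex) (m : comb_map X Y).

Definition push : {freeg edge X} -> {freeg edge Y} :=
  fglift (fun e => dart_chain (map_dart m (e, false))).

HB.instance Definition _ :=
  GRing.isZmodMorphism.Build {freeg edge X} {freeg edge Y} push
    (lift_is_additive (fun e => dart_chain (map_dart m (e, false)))).

Lemma push_dart (d : dart X) : push (dart_chain d) = dart_chain (map_dart m d).
Proof.
case: d => e b; rewrite /push /dart_chain liftU; case: b; rewrite ?scale1r //.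
by rewrite scaleN1r -dart_chain_flip -map_flip.
Qed.

Lemma push_path (p : seq (dart X)) :
  push (path_chain p) = path_chain (map (map_dart m) p).
Proof.
rewrite /path_chain raddf_sum big_map; apply: eq_bigr => d _; exact: push_dart.
Qed.

(** A face may be mapped with its orientation reversed, so the filling is
    transported with the sign by which the attaching loops differ. *)
Lemma fillable_push (n : nat) (z : {freeg edge X}) :
  fillable n z -> fillable n (push z).
Proof.
move=> [c <- cn].
have [s sP] := choice (fun f => path_chain_same_loop (map_attach m f)).
exists (fglift (fun f => << (-1) ^+ s f *g map_face m f >>) c); last first.
  by apply: le_trans cn; apply: l1norm_fglift => f; rewrite l1normU normrX normrN1 expr1n.
rewrite [fglift _ c]fgliftE [boundary2 c]fgliftE !raddf_sum.
apply: eq_bigr => f _; rewrite !raddfZ_int /=; congr (_ *: _).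
by rewrite push_path sP /boundary2 liftU.
Qed.

Lemma circuit_map (p : seq (dart X)) :
  injective (map_vert m) -> injective (map_edge m) ->
  circuit p -> circuit (map (map_dart m) p).
Proof.
move=> vinj einj [[pne cp] up ue]; split; last by rewrite map_edges map_inj_uniq.
  split; first by case: p pne {cp up ue}.
  rewrite cycle_map; apply: sub_cycle cp => d d' /= /eqP dd'.
  by rewrite map_head map_tail dd'.
rewrite -map_comp (eq_map (g := map_vert m \o @dtail X)); last first.
  by move=> d /=; rewrite map_tail.
by rewrite map_comp map_inj_uniq.
Qed.

End Pushforward.

(** Every circuit can be moved by the group so as to pass through one of
    finitely many edges, and by fineness only finitely many short circuits do
    so.  Each of these is a boundary, and moving it back does not increase its
    filling norm. *)
Lemma bounded_circuit_filling (G : groupType) (X : cell_complex)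
    (a : comb_action G X) (k : nat) :
  cocompact a -> fine_graph X -> H1_trivial X ->
  exists M, forall p : seq (dart X), circuit p -> (size p <= k)%N ->
    fillable M (path_chain p).
Proof.
move=> [_ coce _ _] fineX H1.
have [B finB BP] := finite_orbit_reps (act_edge a) coce.
(* The bound is [k.+1] because fineness speaks of positive lengths only. *)
pose S := \bigcup_(e in B) [set p : seq (dart X) |
      [/\ circuit p, (size p <= k.+1)%N & e \in map fst p]].
have finS : finite_set S by apply: bigcup_finite => // e _; apply: fineX.
have [|p [e _ [cp _ _]]|M SM] :=
    finite_set_nat_bound (P := fun p n => fillable n (path_chain p)) finS.
- by move=> p m n mn; apply: fillableW.
- have : cycles1 X (path_chain p) by apply: boundary1_closed_path; case: cp.
  rewrite H1 => -[c _ cE]; exists `|l1norm c|%N; exists c => //.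
  by rewrite gez0_abs // l1norm_ge0.
exists M => p cp szp; have [[pne _] _ _] := cp.
case: p pne cp szp => // d p _; set q := d :: p => cq szq.
have [e Be [g ge]] := BP d.1.
have [d1 dM] := act_dart a; have [e1 eM] := act_edge a.
pose q' := map (map_dart (a g^-1%g)) q.
have -> : path_chain q = push (a g) (path_chain q').
  rewrite push_path /q' -map_comp map_id_in // => x _ /=.
  by rewrite -dM mulgV d1.
apply: fillable_push; apply: SM; exists e => //; split.
- by apply: circuit_map cq; [apply: act_vert_inj | apply: act_edge_inj].
- by rewrite size_map leqW.
by rewrite map_edges /= inE -ge -eM mulVg e1 eqxx.
Qed.

(** * The equivalence *)

Theorem theorem1p3 (R : realType) (G : groupType) (X : cell_complex)
    (a : comb_action G X)
    (cocompact_a : cocompact a)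
    (finite_stab : forall e : edge X, finite_set (edge_stabilizer a e)) :
  (fine_graph (skel1 X) /\ H1_trivial X) <-> (forall k : int, (FV R X k < +oo)%E).
Proof.
split=> [[fineX H1] k|FVoo].
  apply/FV_ltyP; case: k => k; last first.
    by exists 0%N => z _; rewrite leNgt (lt_le_trans _ (l1norm_ge0 z)).
  have [M circM] := bounded_circuit_filling k cocompact_a fineX H1.
  by exists (k * M)%N => z zc zk; apply: fillable_of_circuits circM _ _ zc zk _.
have fill k := (FV_ltyP R X k).1 (FVoo k).
split.
  apply: fine_of_bounded_filling => [e|L].
    exact: finite_star cocompact_a finite_stab.
  have [N NP] := fill L; exists N => p cp szp; apply: NP.
    by apply: boundary1_closed_path; have [] := cp.
  by rewrite (le_trans (l1norm_path_chain p)).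
rewrite /H1_trivial eqEsubset; split; last exact: boundaries1_sub_cycles1.
move=> z zc; have [N NP] := fill (l1norm z).
by have [c cz _] := NP z zc (lexx _); exists c.
Qed.
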